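(* Let $X$ be a path-connected topological space. Assume that there exist a commutative ring $R$ with unit, a subgroup $G\subset R^\times$ such that $1-g\in R^\times$ for any $g\in G$ with $g\neq 1$, and a $G$-local system $\mathcal{L}$ of rank one $R$-modules on $X$ which is nontrivial and such that $H_\cdot(X;\mathcal{L})\neq 0$. Then $X$ does not carry the structure of an $H$-space.
   Context: $R^\times$ is the group of invertible elements of $R$. Spaces carrying local systems are assumed to be path-connected and to admit a universal cover. A local system of $R$-modules on $X$ is a collection of $R$-modules $M_x$, $x\in X$, with isomorphisms $\tau_{[\alpha]}:M_x\to M_y$ for each fixed-endpoint homotopy class of paths $\alpha$ from $x$ to $y$, such that $\tau_{[\mathrm{const}]}=\mathrm{Id}$ and $\tau_{[\alpha]\cdot[\beta]}=\tau_{[\beta]}\tau_{[\alpha]}$. It has rank one if all fibers are free of rank one. For $G\subset R^\times=\mathrm{Aut}_{R\text{-mod}}(R)$, acting on $R$ by multiplication, a rank one $G$-local system is one whose holonomy representation $\rho:\pi_1(X)\to R^\times$ takes values in $G$. It is nontrivial if $\rho$ is nontrivial. The homology is $H_\cdot(X;\mathcal{L})=H_\cdot(C_\cdot(\tilde X)\otimes_{\mathbb{Z}[\pi_1(X)]}R)$, where $\tilde X$ is the universal cover and $\pi_1(X)$ acts on $R$ via $\rho$. An $H$-space is a topological space $X$ endowed with a continuous multiplication $m:X\times X\to X$ and an element $e\in X$ (homotopy unit) such that $m(e,\cdot)$ and $m(\cdot,e)$ are homotopic to the identity through maps that preserve the basepoint $e$. The multiplication is also required to be associative up to homotopy. *)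

(* Defs.v *)
(* [K : realType] stands for the field of real numbers. *)
From HB Require Import structures.
From mathcomp Require Import all_boot all_order all_algebra.
From mathcomp Require Import generic_quotient ring_quotient.
From mathcomp Require Import all_classical reals topology normedtype homotopy.
From mathcomp.multinomials Require Import freeg.

Set Implicit Arguments.
Unset Strict Implicit.
Unset Printing Implicit Defensive.

Import Order.TTheory GRing.Theory Num.Theory.
Import numFieldNormedType.Exports.

Local Open Scope classical_set_scope.
Local Open Scope ring_scope.

Section UnitInterval.
Variable K : realType.

Definition unitI : Type := set_type (`[0, 1]%classic : set K).

HB.instance Definition _ := Topological.on unitI.

Lemma clampI_subproof (t : K) : Num.max 0 (Num.min 1 t) \in (`[0, 1]%classic : set K).
Proof.
by rewrite inE /= in_itv /= le_max lexx /= ge_max ler01 ge_min lexx.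
Qed.

Definition clampI (t : K) : unitI :=
  exist (fun x : K => x \in (`[0, 1]%classic : set K)) _ (clampI_subproof t).

Definition valI (t : unitI) : K := set_val t.

Lemma clampIK t : 0 <= t <= 1 -> valI (clampI t) = t.
Proof. by move=> /andP[t0 t1]; rewrite /valI set_valE /= (min_r t1) (max_r t0). Qed.

Lemma unitI_neq : clampI 0 != clampI 1.
Proof.
apply/eqP => /(congr1 valI); rewrite !clampIK ?lexx ?ler01// => /eqP.
by rewrite eq_sym oner_eq0.
Qed.

HB.instance Definition _ := @isBiPointed.Build unitI _ _ unitI_neq.

Lemma valI_continuous : continuous valI.
Proof. exact: initial_continuous. Qed.

Lemma clampI_continuous : continuous clampI.
Proof.
apply: continuous_comp_initial => t.
apply: (@continuous_max _ _ (cst 0) (fun t : K => Num.min 1 t)).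
  exact: cst_continuous.
by apply: (@continuous_min _ _ (cst 1) id) => //; exact: cst_continuous.
Qed.

End UnitInterval.

Notation Path K x y := {path (unitI K) from x to y}.

Section Concat.
Variables (K : realType) (X : topologicalType) (x y z : X).
Variables (a : Path K x y) (b : Path K y z).

(* First [a], then [b], each at double speed. *)
Definition concat_fun (t : unitI K) : X :=
  if valI t <= 2^-1 then a (clampI (2 * valI t))
  else b (clampI (2 * valI t - 1)).

Lemma concat_continuous : continuous concat_fun.
Proof.
have cl : continuous (fun t : unitI K => a (clampI (2 * valI t))).
  move=> t; apply: (@continuous_comp _ _ _ (fun t => clampI (2 * valI t)) a).
    apply: (@continuous_comp _ _ _ (fun t => 2 * valI t) (@clampI K)).
      by apply: continuousM; [exact: cst_continuous|exact: valI_continuous].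
    exact: clampI_continuous.
  exact: cts_fun.
have cr : continuous (fun t : unitI K => b (clampI (2 * valI t - 1))).
  move=> t; apply: (@continuous_comp _ _ _ (fun t => clampI (2 * valI t - 1)) b).
    apply: (@continuous_comp _ _ _ (fun t => 2 * valI t - 1) (@clampI K)).
      apply: continuousB; last exact: cst_continuous.
      by apply: continuousM; [exact: cst_continuous|exact: valI_continuous].
    exact: clampI_continuous.
  exact: cts_fun.
pose A := @valI K @^-1` [set u | u <= 2^-1].
pose B := @valI K @^-1` [set u | 2^-1 <= u].
have cA : closed A.
  by apply: preimage_closed => [t _|]; [exact: valI_continuous|exact: closed_le].
have cB : closed B.
  by apply: preimage_closed => [t _|]; [exact: valI_continuous|exact: closed_ge].
have AB : A `|` B = setT.
  apply/seteqP; split=> // t _ /=.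
  by have [h|/ltW h] := leP (valI t) 2^-1; [left|right].
apply/continuous_subspace_setT; rewrite -AB; apply: withinU_continuous => //.
- apply: (subspace_eq_continuous _ (continuous_subspaceT cl)) => t.
  by move=> /set_mem h; rewrite /from_subspace /concat_fun ifT.
- apply: (subspace_eq_continuous _ (continuous_subspaceT cr)) => t.
  move=> /set_mem h; rewrite /from_subspace /concat_fun; case: ifP => // h'.
  have -> : valI t = 2^-1 by apply/eqP; rewrite eq_le h h'.
  rewrite divff ?pnatr_eq0// subrr.
  by rewrite (path_zero (s := b)) (path_one (s := a)).
Qed.

Lemma concat_zero : concat_fun zero = x.
Proof.
have v0 : valI (zero : unitI K) = 0 by rewrite clampIK ?lexx ?ler01.
by rewrite /concat_fun v0 invr_ge0 ler0n mulr0 (path_zero (s := a)).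
Qed.

Lemma concat_one : concat_fun one = z.
Proof.
have v1 : valI (one : unitI K) = 1 by rewrite clampIK ?lexx ?ler01.
rewrite /concat_fun v1 leNgt invf_lt1 ?ltr0n// ltr1n /= mulr1.
by rewrite (_ : 2 - 1 = 1) ?(path_one (s := b))// -[2]/(1 + 1) addrK.
Qed.

Definition concat : Path K x z := mk_path concat_continuous concat_zero concat_one.

End Concat.

Section Homotopy.
Variable K : realType.

Definition homotopic (Y Z : topologicalType) (f g : Y -> Z) : Prop :=
  exists H : Y * unitI K -> Z,
    [/\ continuous H, forall y, H (y, zero) = f y & forall y, H (y, one) = g y].

Definition homotopic_fixing (Z : topologicalType) (e : Z) (f g : Z -> Z) :
    Prop :=
  exists H : Z * unitI K -> Z,
    [/\ continuous H, forall z, H (z, zero) = f z, forall z, H (z, one) = g z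
      & forall t, H (e, t) = e].

Definition path_homotopic (X : topologicalType) (x y : X) (a b : Path K x y) :
    Prop :=
  exists H : unitI K * unitI K -> X,
    [/\ continuous H,
        forall s, H (s, zero) = a s, forall s, H (s, one) = b s,
        forall t, H (zero, t) = x & forall t, H (one, t) = y].

Definition path_connected (X : topologicalType) : Prop :=
  forall x y : X, $|Path K x y|.

Definition simply_connected (X : topologicalType) : Prop :=
  path_connected X /\
  forall (x : X) (a : Path K x x), path_homotopic a (cst x : Path K x x).

(* The multiplication need only be associative up to free homotopy. *)
Record is_Hspace (X : topologicalType) (m : X * X -> X) (e : X) : Prop := {
  Hspace_continuous : continuous m;
  Hspace_unitl : homotopic_fixing e (fun x => m (e, x)) id;
  Hspace_unitr : homotopic_fixing e (fun x => m (x, e)) id;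
  Hspace_assoc : homotopic (fun p : X * X * X => m (m (p.1.1, p.1.2), p.2))
                           (fun p : X * X * X => m (p.1.1, m (p.1.2, p.2)))
}.

End Homotopy.

Section LocalSystem.
Variables (K : realType) (R : comUnitRingType) (X : topologicalType).

Record local_system := {
  fiber :> X -> lmodType R;
  transport : forall x y : X, Path K x y -> {linear fiber x -> fiber y};
  transport_bij : forall x y (a : Path K x y), bijective (transport a);
  transport_homotopic : forall x y (a b : Path K x y),
    path_homotopic a b -> transport a =1 transport b;
  transport_cst : forall x, transport (cst x : Path K x x) =1 id;
  transport_concat : forall x y z (a : Path K x y) (b : Path K y z),
    transport (concat a b) =1 transport b \o transport a
}.

Definition rank_one (L : local_system) : Prop :=
  forall x, exists u : L x, bijective (fun c : R => c *: u).

Definition unit_subgroup (G : {pred R}) : Prop :=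
  {subset G <= GRing.unit} /\ divr_closed G.

(* In rank one the scalar by which a loop acts on the fibre exists and is
   unique, so the default value 1 is never used. *)
Definition holonomy (L : local_system) (x0 : X) (a : Path K x0 x0) : R :=
  xget 1 [set c | forall u : L x0, transport L a u = c *: u].

Definition local_system_in (G : {pred R}) (L : local_system) : Prop :=
  forall (x : X) (a : Path K x x), holonomy L a \in G.

Definition nontrivial (L : local_system) (x0 : X) : Prop :=
  exists a : Path K x0 x0, holonomy L a <> 1.

End LocalSystem.

Section UniversalCover.
Variable K : realType.

Definition evenly_covered (E X : topologicalType) (p : E -> X) (U : set X) :
    Prop :=
  exists (J : Type) (V : J -> set E),
    [/\ forall j, open (V j), trivIset setT V,
        p @^-1` U = \bigcup_j V j
      & forall j, exists s : X -> E,
          [/\ {within U, continuous s}, forall x, U x -> V j (s x),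
              forall x, U x -> p (s x) = x & forall e, V j e -> s (p e) = e]].

Definition covering_map (E X : topologicalType) (p : E -> X) : Prop :=
  continuous p /\
  forall x, exists U : set X, [/\ open U, U x & evenly_covered p U].

(* A simply connected covering space together with the action of the
   fundamental group by deck transformations.  [deck a] is determined by the
   other fields: it is the lift of [p] through [p] that sends [cover_base] to
   the end of the lift of [a] at [cover_base]; hence it depends only on the
   class of [a], [deck (concat a b) = deck a \o deck b], and each [deck a] is a
   homeomorphism.  It exists as soon as [X] is locally path-connected. *)
Record universal_cover (X : topologicalType) (x0 : X) := {
  cover_space :> topologicalType;
  cover_map : cover_space -> X;
  cover_base : cover_space;
  cover_map_base : cover_map cover_base = x0;
  cover_covering : covering_map cover_map;
  cover_simply_connected : simply_connected K cover_space;
  deck : Path K x0 x0 -> continuousType cover_space cover_space;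
  deck_over : forall a e, cover_map (deck a e) = cover_map e;
  deck_base : forall (a : Path K x0 x0) e (b : Path K cover_base e),
    (forall t, cover_map (b t) = a t) -> deck a cover_base = e
}.

End UniversalCover.

Definition freeg_ext (T : choiceType) (V : zmodType) (f : T -> V)
    (c : {freeg T}) : V :=
  fglift (f : T -> zmodule V) c.

Lemma freeg_extB (T : choiceType) (V : zmodType) (f : T -> V) :
  {morph freeg_ext f : c d / c - d}.
Proof. by move=> c d; exact: (@lift_is_additive _ _ (zmodule V) f). Qed.

Lemma freeg_extU (T : choiceType) (V : zmodType) (f : T -> V) x :
  freeg_ext f << x >> = f x.
Proof. by rewrite /freeg_ext liftU scale1r. Qed.

Section SingularChains.
Variable K : realType.

Definition simplex (n : nat) : set 'rV[K]_n.+1 :=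
  [set x | (forall i, 0 <= x 0 i) /\ \sum_i x 0 i = 1].

Arguments simplex n : clear implicits.

Definition face_fun n (i : 'I_n.+2) (x : 'rV[K]_n.+1) : 'rV[K]_n.+2 :=
  \row_j (if unlift i j is Some k then x 0 k else 0).

Lemma face_subproof n (i : 'I_n.+2) (x : simplex n) :
  face_fun i (set_val x) \in simplex n.+1.
Proof.
have [x0 x1] := set_mem (valP x); apply/mem_set; split.
  by move=> j; rewrite mxE; case: unlift.
rewrite (bigD1_ord i) //= mxE unlift_none add0r -x1.
by apply: eq_bigr => j _; rewrite mxE liftK.
Qed.

Definition face n (i : 'I_n.+2) (x : simplex n) : simplex n.+1 :=
  exist (fun y => y \in simplex n.+1) _ (face_subproof i x).

Lemma face_continuous n (i : 'I_n.+2) : continuous (face i).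
Proof.
apply: continuous_comp_initial => x.
move=> A /= [P nP PA].
suff : \forall y \near x, forall j, P 0 j (face_fun i (set_val y) 0 j).
  move=> h; suff : nbhs x ((set_val \o face i) @^-1` A) by [].
  by apply: filterS h => y Py; apply: PA => r j; rewrite (ord1 r); exact: Py.
apply: (@filter_forall _ 'I_n.+2
  (fun j (y : simplex n) => P 0 j (face_fun i (set_val y) 0 j)) (nbhs x)) => j.
suff cj : continuous (fun y : simplex n => face_fun i (set_val y) 0 j).
  exact: (cj x) (nP 0 j).
under [X in continuous X]funext => y do rewrite mxE.
case: unlift => [k|]; last exact: cst_continuous.
move=> y; apply: (@continuous_comp _ _ _ set_val (fun z : 'rV[K]_n.+1 => z 0 k)).
  exact: initial_continuous.
exact: coord_continuous.
Qed.

HB.instance Definition _ n (i : 'I_n.+2) :=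
  isContinuous.Build _ _ (@face n i) (@face_continuous n i).

Definition sing (n : nat) (X : topologicalType) : Type :=
  continuousType (simplex n) X.

HB.instance Definition _ n X := Choice.on (sing n X).

Definition chain (n : nat) (X : topologicalType) := {freeg (sing n X)}.

Definition chain_map n (X Y : topologicalType) (f : continuousType X Y) :
    chain n X -> chain n Y :=
  freeg_ext (fun s : sing n X => << (f \o s : sing n Y) >>).

Definition boundary n (X : topologicalType) : chain n.+1 X -> chain n X :=
  freeg_ext (fun s : sing n.+1 X =>
    \sum_(i < n.+2) << (-1) ^+ i *g (s \o face i : sing n X) >>).

End SingularChains.

Section Tensor.
Variables (Pi : Type) (A B : zmodType) (actA : Pi -> A -> A) (actB : Pi -> B -> B).

(* The subgroup of the free abelian group on [A * B] spanned by the relations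
   of the tensor product over the group ring of [Pi], whose elements are
   integer combinations of elements of [Pi]. *)
Inductive tensor_rel : {freeg (A * B)%type} -> Prop :=
| Tensor_addl a a' b :
    tensor_rel (<< (a + a', b) >> - << (a, b) >> - << (a', b) >>)
| Tensor_addr a b b' :
    tensor_rel (<< (a, b + b') >> - << (a, b) >> - << (a, b') >>)
| Tensor_act g a b :
    tensor_rel (<< (actA g a, b) >> - << (a, actB g b) >>)
| Tensor_0 : tensor_rel 0
| Tensor_sub u v : tensor_rel u -> tensor_rel v -> tensor_rel (u - v).

Definition tensor_null : {pred {freeg (A * B)%type}} :=
  fun u => `[< tensor_rel u >].

Lemma tensor_null_closed : zmod_closed tensor_null.
Proof.
split=> [|u v /asboolP hu /asboolP hv]; apply/asboolP.
  exact: Tensor_0.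
exact: Tensor_sub.
Qed.

HB.instance Definition _ :=
  GRing.isZmodClosed.Build {freeg (A * B)%type} tensor_null tensor_null_closed.

Definition tensor : Type := Quotient.quot tensor_null.

HB.instance Definition _ := GRing.Zmodule.on tensor.

Definition tens (a : A) (b : B) : tensor :=
  (\pi_(Quotient.quot tensor_null) << (a, b) >>)%qT.

Lemma tensor_pi_eq0 u : tensor_rel u ->
  (\pi_(Quotient.quot tensor_null) u = 0 :> Quotient.quot tensor_null)%qT.
Proof.
move=> hu; rewrite -[RHS](@raddf0 _ _ \pi_(Quotient.quot tensor_null)%qT).
by apply/eqP; rewrite -Quotient.idealrBE subr0; apply/asboolP.
Qed.

Lemma tensDl a a' b : tens (a + a') b = tens a b + tens a' b.
Proof.
apply/eqP; rewrite -subr_eq0 opprD addrA /tens -!raddfB; apply/eqP.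
exact/tensor_pi_eq0/Tensor_addl.
Qed.

Lemma tensDr a b b' : tens a (b + b') = tens a b + tens a b'.
Proof.
apply/eqP; rewrite -subr_eq0 opprD addrA /tens -!raddfB; apply/eqP.
exact/tensor_pi_eq0/Tensor_addr.
Qed.

Lemma tens_act g a b : tens (actA g a) b = tens a (actB g b).
Proof.
apply/eqP; rewrite -subr_eq0 /tens -!raddfB; apply/eqP.
exact/tensor_pi_eq0/Tensor_act.
Qed.

End Tensor.

Section TensorMap.
Variables (Pi : Type) (A A' B : zmodType).
Variables (actA : Pi -> A -> A) (actA' : Pi -> A' -> A') (actB : Pi -> B -> B).
Variable f : A -> A'.

(* [f (x) id], meaningful for [f] additive and equivariant. *)
Definition tensor_map (t : tensor actA actB) : tensor actA' actB :=
  freeg_ext (fun p : A * B => tens actA' actB (f p.1) p.2)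
    (repr (t : Quotient.quot (tensor_null actA actB))).

Hypothesis fD : {morph f : x y / x + y}.
Hypothesis f_act : forall g, {morph f : x / actA g x >-> actA' g x}.

Lemma tensor_map_pi (u : {freeg (A * B)%type}) :
  tensor_map (\pi_(Quotient.quot (tensor_null actA actB)) u)%qT =
  freeg_ext (fun p : A * B => tens actA' actB (f p.1) p.2) u.
Proof.
rewrite /tensor_map; set F := fun p => _; set v := repr _.
suff h w : tensor_rel actA actB w -> freeg_ext F w = 0.
  apply/eqP; rewrite -subr_eq0 -freeg_extB; apply/eqP/h/asboolP.
  have := Quotient.idealrBE (tensor_null actA actB) v u.
  by rewrite reprK eqxx.
elim=> [a a' b|a b b'|g a b||w1 w2 _ h1 _ h2].
- by rewrite !freeg_extB !freeg_extU /F /= fD tensDl -addrA -opprD subrr.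
- by rewrite !freeg_extB !freeg_extU /F /= tensDr -addrA -opprD subrr.
- by rewrite freeg_extB !freeg_extU /F /= f_act tens_act subrr.
- by rewrite -[0](subrr 0) freeg_extB subrr.
- by rewrite freeg_extB h1 h2 subrr.
Qed.

Lemma tensor_mapE a b : tensor_map (tens actA actB a b) = tens actA' actB (f a) b.
Proof. by rewrite tensor_map_pi freeg_extU. Qed.

Lemma tensor_mapB : {morph tensor_map : t u / t - u}.
Proof.
move=> t u; rewrite -[t]reprK -[u]reprK.
by rewrite -[X in tensor_map X]raddfB !tensor_map_pi freeg_extB.
Qed.

End TensorMap.

Section TwistedHomology.
Variables (K : realType) (R : comUnitRingType) (X : topologicalType) (x0 : X).
Variables (U : universal_cover K x0) (L : local_system K R X).

(* A loop [a] acts on chains of the cover by the deck transformation [deck a]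
   and on [R] by the holonomy of [a]; since [R] is commutative, left and right
   modules need not be distinguished.  With the relation
   [deck a . c (x) r = c (x) rho(a) r], the element [s (x) r], for a simplex [s]
   of the cover, corresponds to the simplex [p \o s] of [X] with, as
   coefficient in the fibre over its first vertex, the transport of [r] along
   the projection of a path from the base point to the first vertex of [s]. *)
Definition twisted_chain (n : nat) : Type :=
  tensor (fun a : Path K x0 x0 => @chain_map K n U U (deck U a))
         (fun (a : Path K x0 x0) (r : R) => holonomy L a * r).

HB.instance Definition _ n := GRing.Zmodule.on (twisted_chain n).

Definition twisted_boundary n : twisted_chain n.+1 -> twisted_chain n :=
  @tensor_map _ _ _ _ _ _ _ (@boundary K n U).

Definition twisted_cycle n : twisted_chain n -> Prop :=
  match n with
  | 0 => fun=> True
  | n'.+1 => fun z => twisted_boundary z = 0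
  end.

Definition homology_nonzero : Prop :=
  exists n (z : twisted_chain n),
    twisted_cycle z /\ ~ exists w : twisted_chain n.+1, twisted_boundary w = z.

End TwistedHomology.

(* Main.v *)
From mathcomp Require Import homotopy.
Require Import Defs.
From HB Require Import structures.
From mathcomp Require Import all_boot all_order all_algebra.
From mathcomp Require Import generic_quotient ring_quotient.
From mathcomp Require Import all_classical reals topology normedtype.
From mathcomp.multinomials Require Import freeg.
From mathcomp Require Import zify.

(** Let [g] be a loop at the homotopy unit [e].  The translations [m (g t, -)]
    form a homotopy from [m (e, -)] to itself, and [m (e, -)] is homotopic to
    the identity; together they give a self-homotopy of the identity of [X]
    under which each point [x] runs through a loop, its translation loop.

    Lift this self-homotopy to the universal cover, starting at the identity
    ([homotopy_lifting]).  Since a lift is determined by its starting point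
    ([lift_unique]), the lifted homotopy commutes with the deck
    transformations and ends with the deck transformation of the translation
    loop [c] at the base point ([deck_unique]).  The prism operator of an
    equivariant homotopy is equivariant ([prism_chain_map]), so it makes the
    identity and the map induced by [deck c] agree on twisted homology
    ([twisted_homotopy]).  But in the tensor product [deck c] acts as
    multiplication by the holonomy [rho c] ([twisted_map_deck]).  Hence
    [1 - rho c] annihilates the twisted homology.

    The translation loop at [x] is freely homotopic to [g] along any path from
    [e] to [x] ([transport_translation_loop]), so each value of the holonomy is
    some [rho c] ([holonomy_translation_loop]).  A value other than [1] makes
    [1 - rho c] invertible, and the homology vanishes. *)

Set Implicit Arguments.
Unset Strict Implicit.
Unset Printing Implicit Defensive.

Import Order.TTheory GRing.Theory Num.Theory.
Import numFieldNormedType.Exports.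

Local Open Scope classical_set_scope.
Local Open Scope ring_scope.

(** * Continuity at a point *)

Lemma continuous_at_comp (Y Z W : topologicalType) (f : Y -> Z) (g : Z -> W) y :
  {for y, continuous f} -> {for f y, continuous g} ->
  {for y, continuous (fun x => g (f x))}.
Proof. exact: continuous_comp. Qed.

Lemma continuous_at_pair (Y Z W : topologicalType) (f : Y -> Z) (g : Y -> W) y :
  {for y, continuous f} -> {for y, continuous g} ->
  {for y, continuous (fun x => (f x, g x))}.
Proof. by move=> cf cg; apply: cvg_pair. Qed.

Lemma continuous_at_near (Y Z : topologicalType) (f g : Y -> Z) y :
  (\forall x \near y, f x = g x) -> {for y, continuous f} ->
  {for y, continuous g}.
Proof.
move=> fg cf; rewrite /prop_for /continuous_at -(nbhs_singleton fg).
by move=> A /cf; apply: filterS2 fg => x /= <-.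
Qed.

Lemma continuous_at_open (Y Z : topologicalType) (f : Y -> Z) y (A : set Z) :
  {for y, continuous f} -> open A -> A (f y) -> \forall x \near y, A (f x).
Proof. by move=> cf oA Afy; apply: cf; exact: open_nbhs_nbhs. Qed.

Lemma continuous_fst (Y Z : topologicalType) : continuous (@fst Y Z).
Proof. by move=> x; exact: cvg_fst. Qed.

Lemma continuous_snd (Y Z : topologicalType) : continuous (@snd Y Z).
Proof. by move=> x; exact: cvg_snd. Qed.

(** * The unit interval *)

Section Interval.
Variable K : realType.
Implicit Types s t : unitI K.

Lemma valI_itv t : 0 <= valI t <= 1.
Proof. by have := set_mem (valP t); rewrite /= in_itv. Qed.

Lemma valIK : cancel (@valI K) (@clampI K).
Proof. by move=> t; apply: val_inj; exact: (clampIK (valI_itv t)). Qed.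

Lemma valI0 : valI (zero : unitI K) = 0.
Proof. by rewrite clampIK ?lexx ?ler01. Qed.

Lemma valI1 : valI (one : unitI K) = 1.
Proof. by rewrite clampIK ?lexx ?ler01. Qed.

(** The form in which the connectedness of the interval is used. *)
Lemma unitI_locally_constant (P : unitI K -> Prop) :
  (forall t, \forall s \near t, P s <-> P t) -> forall s t, P s -> P t.
Proof.
move=> lcP s t Ps.
have conn : connected [set: unitI K].
  have -> : [set: unitI K] = @clampI K @` `[0, 1].
    apply/seteqP; split=> // u _; exists (valI u); last exact: valIK.
    by rewrite /= in_itv /= valI_itv.
  apply: connected_continuous_connected; first exact: segment_connected.
  exact/continuous_subspaceT/clampI_continuous.
have oP : open [set u | P u].
  rewrite openE => u /= Pu; rewrite /interior.
  by apply: filterS (lcP u) => v [_]; exact.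
have oNP : open [set u | ~ P u].
  rewrite openE => u /= Pu; rewrite /interior.
  by apply: filterS (lcP u) => v [h _] /h.
suff PT : [set u | P u] = setT by have : [set u | P u] t by rewrite PT.
apply: conn; first by exists s.
- by exists [set u | P u] => //; rewrite setTI.
- exists [set u | P u]; last by rewrite setTI.
  by rewrite -[X in closed X]setCK; apply: open_closedC.
Qed.

Definition minI s t : unitI K := clampI (Num.min (valI s) (valI t)).

Lemma valI_min s t : valI (minI s t) = Num.min (valI s) (valI t).
Proof.
rewrite clampIK // le_min ge_min.
by have /andP[-> ->] := valI_itv s; have /andP[-> _] := valI_itv t.
Qed.

Lemma minI_l s t : valI s <= valI t -> minI s t = s.
Proof. by move=> st; rewrite /minI min_l // valIK. Qed.

Lemma minI_r s t : valI t <= valI s -> minI s t = t.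
Proof. by move=> ts; rewrite /minI min_r // valIK. Qed.

Lemma minI_continuous t : continuous (minI^~ t).
Proof.
move=> s.
apply: (@continuous_at_comp _ _ _ (fun s => Num.min (valI s) (valI t)));
  last exact: clampI_continuous.
apply: (@continuous_min _ _ (@valI K) (fun=> valI t)).
  exact: valI_continuous.
exact: cst_continuous.
Qed.

End Interval.

(** * Lifts through a covering map *)

Section Covering.
Variables (K : realType) (E X : topologicalType) (p : E -> X).
Hypothesis cp : covering_map p.

(** [s] is the inverse of the homeomorphism from the sheet [V] onto [U]. *)
Definition is_sheet (U : set X) (V : set E) (s : X -> E) : Prop :=
  [/\ open V, forall x, U x -> {for x, continuous s},
      forall x, U x -> V (s x), forall x, U x -> p (s x) = x
    & forall e, V e -> s (p e) = e].

(** One neighbourhood [U] serves all points of the fibre, so that it can be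
    chosen before it is known which sheet a lift has reached. *)
Lemma covering_sheet x : exists U : set X, [/\ open U, U x &
  forall e, U (p e) -> exists V s, V e /\ is_sheet U V s].
Proof.
have [U [oU Ux [J [V [oV _ pU secV]]]]] := cp.2 x.
exists U; split=> // e Ue.
have [j _ Vje] : (\bigcup_j V j) e by rewrite -pU.
have [s [cs sV ps sp]] := secV j.
exists (V j), s; split=> //; split=> //.
move=> y Uy; move: cs; rewrite continuous_open_subspace// => /(_ y).
by apply; rewrite inE.
Qed.

(** Two points of a fibre on the same sheet are equal, so distinct ones lie on
    different, hence disjoint, sheets. *)
Lemma fibre_separated e e' : p e = p e' -> e <> e' -> exists V V' : set E,
  [/\ open V, open V', V e, V' e' & V `&` V' = set0].
Proof.
move=> pe ee'; have [U [oU Ue [J [V [oV tV pU secV]]]]] := cp.2 (p e).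
have [j _ Vje] : (\bigcup_j V j) e by rewrite -pU.
have [k _ Vke'] : (\bigcup_j V j) e' by rewrite -pU /= -pe.
exists (V j), (V k); split=> //; apply/seteqP; split=> // z Vz.
have jk : j = k by apply: tV => //; exists z.
apply: ee'; rewrite -jk in Vke'.
have [s [_ _ _ sp]] := secV j.
by rewrite -(sp e)// -(sp e')// pe.
Qed.

(** The set where two lifts agree is open because [p] is injective on a sheet,
    and closed because distinct points of a fibre are separated. *)
Lemma lift_unique (f g : unitI K -> E) : continuous f -> continuous g ->
  (forall t, p (f t) = p (g t)) -> f zero = g zero -> f =1 g.
Proof.
move=> cf cg pfg fg0 t.
apply: (@unitI_locally_constant K (fun t => f t = g t) _ _ _ fg0) => {}t.
have [fg|fg] := pselect (f t = g t).
  have [U [oU Ux /(_ (f t) Ux) [V [s [Vf [oV _ _ _ sp]]]]]] :=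
    covering_sheet (p (f t)).
  have Vg : V (g t) by rewrite -fg.
  have nf := continuous_at_open (cf t) oV Vf.
  have ng := continuous_at_open (cg t) oV Vg.
  apply: filterS2 nf ng => u Vfu Vgu; split=> // _.
  by rewrite -(sp (f u))// -(sp (g u))// pfg.
have [V [V' [oV oV' Vf Vg VV']]] := fibre_separated (pfg t) fg.
have nf := continuous_at_open (cf t) oV Vf.
have ng := continuous_at_open (cg t) oV' Vg.
apply: filterS2 nf ng => u Vfu Vgu; split=> // fgu.
by have : (V `&` V') (f u) by [split=> //; rewrite fgu]; rewrite VV'.
Qed.

End Covering.

(** * Homotopy lifting *)

Section HomotopyLifting.
Variables (K : realType) (E X Y : topologicalType) (p : E -> X).
Variables (h : Y * unitI K -> X) (f : Y -> E).
Hypothesis cp : covering_map p.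
Hypothesis ch : continuous h.
Hypothesis cf : continuous f.
Hypothesis pf : forall y, p (f y) = h (y, zero).

(** Stopping the homotopy at time [t], rather than restricting it to the times
    before [t], keeps all partial lifts on the same domain. *)
Definition lifts_until (g : Y * unitI K -> E) (t : unitI K) (y : Y) : Prop :=
  (forall s, {for (y, s), continuous g} /\ p (g (y, s)) = h (y, minI s t)) /\
  g (y, zero) = f y.

Definition liftable_until (t : unitI K) (y0 : Y) : Prop :=
  exists g, \forall y \near y0, lifts_until g t y.

Lemma truncate_continuous t :
  continuous (fun z : Y * unitI K => (z.1, minI z.2 t)).
Proof.
move=> z; apply: (@continuous_at_pair _ _ _ fst (fun z => minI z.2 t)).
  exact: continuous_fst.
apply: (@continuous_at_comp _ _ _ snd (fun s => minI s t)).
  exact: continuous_snd.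
exact: minI_continuous.
Qed.

Lemma liftable_until0 y0 : liftable_until zero y0.
Proof.
exists (fun z => f z.1); apply: nearW => y; split=> // s; split.
  by apply: (@continuous_at_comp _ _ _ fst f); [exact: continuous_fst|exact: cf].
by rewrite pf minI_r // valI0; case/andP: (valI_itv s).
Qed.

Lemma liftable_until_le y0 t t' : valI t <= valI t' ->
  liftable_until t' y0 -> liftable_until t y0.
Proof.
move=> tt' [g gP]; exists (fun z => g (z.1, minI z.2 t)).
apply: filterS gP => y [gP g0]; split=> [s|]; last first.
  by rewrite /= minI_l ?g0 // valI0; case/andP: (valI_itv t).
split.
  apply: (@continuous_at_comp _ _ _ (fun z => (z.1, minI z.2 t)) g).
    exact: truncate_continuous.
  exact: (gP _).1.
by rewrite (gP _).2 [in LHS]minI_l // valI_min ge_min tt' orbT.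
Qed.

(** While the homotopy stays over an evenly covered set, the lift continues as
    the homotopy followed by the section onto the sheet reached at time [t]. *)
Lemma liftable_until_extend y0 t t' (U : set X) : valI t <= valI t' ->
  (forall e, U (p e) -> exists V s, V e /\ is_sheet p U V s) ->
  (\forall y \near y0, forall s, valI t <= valI s <= valI t' -> U (h (y, s))) ->
  liftable_until t y0 -> liftable_until t' y0.
Proof.
move=> tt' sheetU hU [g gP].
have [gy0 _] := nbhs_singleton gP.
have [V [sec [Vg [oV csec Vsec psec secp]]]] : exists V s,
    V (g (y0, t)) /\ is_sheet p U V s.
  apply: sheetU; rewrite (gy0 t).2 minI_l //.
  by apply: (nbhs_singleton hU); rewrite lexx.
have gV : \forall y \near y0, V (g (y, t)).
  apply: (@continuous_at_open _ _ (fun y => g (y, t))) => //.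
  apply: (@continuous_at_comp _ _ _ (fun y => (y, t)) g); last exact: (gy0 _).1.
  apply: (@continuous_at_pair _ _ _ id (cst t)); first exact: cvg_id.
  exact: cst_continuous.
pose g' z := if valI z.2 <= valI t then g z else sec (h (z.1, minI z.2 t')).
have : \forall y \near y0, \forall x \near y, [/\ lifts_until g t x,
    V (g (x, t)) & forall s, valI t <= valI s <= valI t' -> U (h (x, s))].
  have nP : \forall y \near y0, [/\ lifts_until g t y, V (g (y, t)) &
      forall s, valI t <= valI s <= valI t' -> U (h (y, s))].
    by apply: filterS3 gP gV hU.
  by apply: filterS (nbhs_interior nP).
exists g'; near=> y.
have Py : \forall x \near y, [/\ lifts_until g t x,
    V (g (x, t)) & forall s, valI t <= valI s <= valI t' -> U (h (x, s))].
  by near: y.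
have [[gP1 gP2] gVy hUy] := nbhs_singleton Py.
split=> [s|]; last first.
  by rewrite /g' /= valI0 ifT //; case/andP: (valI_itv t).
have U' : valI t <= valI s -> U (h (y, minI s t')).
  by move=> ts; apply: hUy; rewrite valI_min le_min ge_min ts tt' lexx orbT.
split; last first.
  rewrite /g' /=; case: leP => [st|/ltW/U'/psec//].
  by rewrite (gP1 s).2 !minI_l // (le_trans st).
have [ts|st] := leP (valI t) (valI s); last first.
  apply: continuous_at_near (gP1 s).1.
  have : \forall z \near (y, s), valI z.2 < valI t.
    apply: (@continuous_at_open _ _ (fun z => valI z.2) _ [set u | u < valI t]).
    + apply: (@continuous_at_comp _ _ _ snd (@valI K)).
        exact: continuous_snd.
      exact: valI_continuous.
    + exact: open_lt.
    + by [].
  by apply: filterS => z /ltW zt; rewrite /g' zt.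
(* From time [t] on, [g'] is locally given by the section alone: at nearby
   earlier times the old lift is still in the sheet [V]. *)
apply: (@continuous_at_near _ _ (fun z => sec (h (z.1, minI z.2 t')))).
  have Vz : \forall z \near (y, s), V (g (z.1, minI z.2 t)).
    apply: (@continuous_at_open _ _ (fun z => g (z.1, minI z.2 t))) => //.
      apply: (@continuous_at_comp _ _ _ (fun z => (z.1, minI z.2 t)) g).
        exact: truncate_continuous.
      exact: (gP1 _).1.
    by rewrite /= minI_r.
  have Pz := (@continuous_fst Y (unitI K) (y, s) _ Py).
  apply: filterS2 Vz Pz => -[x u] /= Vz [[gx _] _ _].
  rewrite /g' /=; case: ifP => // ut; rewrite minI_l // in Vz.
  by rewrite -(secp _ Vz) (gx u).2 !minI_l // (le_trans ut).
apply: (@continuous_at_comp _ _ _ (fun z => h (z.1, minI z.2 t')) sec).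
  apply: (@continuous_at_comp _ _ _ (fun z => (z.1, minI z.2 t')) h).
    exact: truncate_continuous.
  exact: ch.
exact/csec/U'.
Unshelve. all: by end_near. Qed.

(** Near each time the homotopy stays over an evenly covered set, so whether a
    partial lift exists does not change there. *)
Lemma liftable y0 t : liftable_until t y0.
Proof.
apply: (@unitI_locally_constant K (liftable_until^~ y0)); last first.
  exact: liftable_until0.
move=> {}t.
have [U [oU Uh sheetU]] := covering_sheet cp (h (y0, t)).
have [[A B] /= [nA nB] AB] := continuous_at_open (@ch (y0, t)) oU Uh.
have /nbhs_ballP[r /= r0 rB] : nbhs (valI t) (@clampI K @^-1` B).
  by apply: clampI_continuous; rewrite valIK.
have ext t1 t2 : valI t1 <= valI t2 -> ball (valI t) r (valI t1) ->
    ball (valI t) r (valI t2) -> liftable_until t1 y0 -> liftable_until t2 y0.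
  move=> t12 b1 b2; apply: (liftable_until_extend t12 sheetU).
  apply: filterS nA => y Ay u /andP[t1u ut2]; apply: (AB (y, u)); split=> //=.
  rewrite -[u]valIK; apply: rB; move: b1 b2; rewrite /ball /=.
  rewrite !ltr_distlC => /andP[tt1 _] /andP[_ t2t].
  by rewrite (lt_le_trans tt1 t1u) (le_lt_trans ut2 t2t).
have nt : \forall s \near t, ball (valI t) r (valI s).
  by apply: valI_continuous; exact: nbhsx_ballx.
apply: filterS nt => s bs; have bt : ball (valI t) r (valI t) by exact: ballxx.
have [st|/ltW ts] := leP (valI s) (valI t).
  by split; [exact: ext|exact: liftable_until_le].
by split; [exact: liftable_until_le|exact: ext].
Qed.

(** The local lifts agree where they overlap, because a lift of a path is
    determined by its starting point. *)
Lemma homotopy_lifting : exists H : Y * unitI K -> E,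
  [/\ continuous H, forall y t, p (H (y, t)) = h (y, t)
    & forall y, H (y, zero) = f y].
Proof.
have /choice[G GP] := fun y0 => liftable y0 one.
have min1 s : minI s one = s by rewrite minI_l // valI1; case/andP: (valI_itv s).
(* At [(y, t)] the local lift chosen around [y] itself is used. *)
pose H z := G z.1 z; exists H; split.
- move=> [y0 t]; apply: (@continuous_at_near _ _ (G y0)); last first.
    by have [/(_ t)[]] := nbhs_singleton (GP y0).
  have nG : \forall z \near (y0, t), lifts_until (G y0) one z.1.
    exact: (@continuous_fst Y (unitI K) (y0, t) _ (GP y0)).
  apply: filterS nG => -[y s] /= [Gy Gy0]; rewrite /H /=.
  have [Gyy Gyy0] := nbhs_singleton (GP y).
  apply: (@lift_unique K E X p cp (fun s => G y0 (y, s)) (fun s => G y (y, s))).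
  + move=> u; apply: (continuous_at_comp (f := pair y)) (Gy u).1.
    apply: (@continuous_at_pair _ _ _ (cst y) id); last exact: cvg_id.
    exact: cst_continuous.
  + move=> u; apply: (continuous_at_comp (f := pair y)) (Gyy u).1.
    apply: (@continuous_at_pair _ _ _ (cst y) id); last exact: cvg_id.
    exact: cst_continuous.
  + by move=> u; rewrite (Gy u).2 (Gyy u).2.
  + by rewrite Gy0 Gyy0.
- move=> y t; have [/(_ t)[_ pG] _] := nbhs_singleton (GP y).
  by rewrite pG min1.
- by move=> y; have [] := nbhs_singleton (GP y).
Qed.

End HomotopyLifting.

(** * Transport around squares *)

Section Transport.
Variables (K : realType) (X : topologicalType).

Lemma clampI_le0 (a : K) : a <= 0 -> clampI a = zero.
Proof.
move=> a0; apply: val_inj; rewrite /= (min_r (le_trans a0 ler01)) (max_l a0).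
by rewrite min_r ?ler01 // maxxx.
Qed.

Lemma clampI_ge1 (a : K) : 1 <= a -> clampI a = one.
Proof.
by move=> a1; apply: val_inj; rewrite /= (min_l a1) minxx.
Qed.

Lemma concatE (x y z : X) (a : Path K x y) (b : Path K y z) t :
  concat a b t = if valI t <= 2^-1 then a (clampI (2 * valI t))
                 else b (clampI (2 * valI t - 1)).
Proof. by []. Qed.

(** Both ways around a square are homotopic: the square contains the straight
    homotopy between the two edge paths of its domain. *)
Lemma square_path_homotopic (w x y z : X) (bottom : Path K w x)
    (right : Path K x z) (left : Path K w y) (top : Path K y z)
    (Q : unitI K * unitI K -> X) :
  continuous Q ->
  (forall s, Q (s, zero) = bottom s) -> (forall t, Q (one, t) = right t) ->
  (forall t, Q (zero, t) = left t) -> (forall s, Q (s, one) = top s) ->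
  path_homotopic (concat bottom right) (concat left top).
Proof.
move=> cQ Qb Qr Ql Qt.
pose a (s : unitI K) : K := valI (clampI (2 * valI s)).
pose b (s : unitI K) : K := valI (clampI (2 * valI s - 1)).
pose mix (u v t : K) : unitI K := clampI ((1 - t) * u + t * v).
have mix0 u v : mix u v 0 = clampI u by rewrite /mix subr0 mul1r mul0r addr0.
have mix1 u v : mix u v 1 = clampI v by rewrite /mix subrr mul1r mul0r add0r.
have half (s : unitI K) : (valI s <= 2^-1) = (2 * valI s <= 1).
  by rewrite -ler_pdivlMl ?ltr0n // mulr1.
exists (fun st => Q (mix (a st.1) (b st.1) (valI st.2),
                     mix (b st.1) (a st.1) (valI st.2))); split.
- move=> [s t]; apply: (@continuous_at_comp _ _ _ (fun st : unitI K * unitI K =>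
    (mix (a st.1) (b st.1) (valI st.2), mix (b st.1) (a st.1) (valI st.2))) Q);
    last exact: cQ.
  have cI (f : unitI K * unitI K -> K) : continuous f ->
      continuous (fun st => clampI (f st)).
    move=> f_cont st; apply: (@continuous_at_comp _ _ _ f (@clampI K)).
      exact: f_cont.
    exact: clampI_continuous.
  have cfst : continuous (fun st : unitI K * unitI K => valI st.1).
    move=> st; apply: (@continuous_at_comp _ _ _ fst (@valI K)).
      exact: continuous_fst.
    exact: valI_continuous.
  have csnd : continuous (fun st : unitI K * unitI K => valI st.2).
    move=> st; apply: (@continuous_at_comp _ _ _ snd (@valI K)).
      exact: continuous_snd.
    exact: valI_continuous.
  have cdouble : continuous (fun st : unitI K * unitI K => 2 * valI st.1).
    by move=> st; apply: cvgM; [exact: cvg_cst|exact: cfst].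
  have ca : continuous (fun st : unitI K * unitI K => a st.1).
    move=> st; apply: (@continuous_at_comp _ _ _
      (fun st : unitI K * unitI K => clampI (2 * valI st.1)) (@valI K)).
      exact: cI.
    exact: valI_continuous.
  have cb : continuous (fun st : unitI K * unitI K => b st.1).
    move=> st; apply: (@continuous_at_comp _ _ _
      (fun st : unitI K * unitI K => clampI (2 * valI st.1 - 1)) (@valI K)).
      apply: cI => {}st.
      by apply: cvgB; [exact: cdouble|exact: cvg_cst].
    exact: valI_continuous.
  have cmix (f g : unitI K * unitI K -> K) : continuous f -> continuous g ->
      continuous (fun st => mix (f st) (g st) (valI st.2)).
    move=> f_cont g_cont; apply: cI => st; apply: cvgD.
      apply: cvgM; last exact: f_cont.
      by apply: cvgB; [exact: cvg_cst|exact: csnd].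
    by apply: cvgM; [exact: csnd|exact: g_cont].
  apply: (@continuous_at_pair _ _ _
    (fun st => mix (a st.1) (b st.1) (valI st.2))); exact: cmix.
- move=> s /=; rewrite valI0 !mix0 /a /b !valIK /concat /concat_fun /mk_path half.
  case: leP => [h|/ltW h].
    by rewrite (@clampI_le0 (_ - 1)) ?subr_le0 // Qb.
  by rewrite (@clampI_ge1 (2 * _)) // Qr.
- move=> s /=; rewrite valI1 !mix1 /a /b !valIK /concat /concat_fun /mk_path half.
  case: leP => [h|/ltW h].
    by rewrite (@clampI_le0 (_ - 1)) ?subr_le0 // Ql.
  by rewrite (@clampI_ge1 (2 * _)) // Qt.
- move=> t /=; rewrite /a /b valI0 mulr0 sub0r !(@clampI_le0 (- 1)) ?lerN10 //.
  rewrite !(@clampI_le0 0) // valI0 /mix !mulr0 addr0 clampI_le0 //.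
  by rewrite Qb path_zero.
- move=> t /=; rewrite /a /b valI1 mulr1.
  have h : (2 - 1 : K) = 1 by rewrite -[2]/(1 + 1) addrK.
  rewrite h !clampI_ge1 ?ler1n // valI1 /mix !mulr1 subrK clampI_ge1 //.
  by rewrite Qr path_one.
Qed.


Lemma transport_square (R : comUnitRingType) (L : local_system K R X)
    (w x y z : X) (bottom : Path K w x) (right : Path K x z)
    (left : Path K w y) (top : Path K y z) (Q : unitI K * unitI K -> X) :
  continuous Q ->
  (forall s, Q (s, zero) = bottom s) -> (forall t, Q (one, t) = right t) ->
  (forall t, Q (zero, t) = left t) -> (forall s, Q (s, one) = top s) ->
  forall u, transport L right (transport L bottom u) =
            transport L top (transport L left u).
Proof.
move=> cQ Qb Qr Ql Qt u.
have := @transport_homotopic _ _ _ L _ _ _ _ (square_path_homotopic cQ Qb Qr Ql Qt) u.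
by rewrite !transport_concat.
Qed.

Definition revI (t : unitI K) : unitI K := clampI (1 - valI t).

Lemma revI0 : revI zero = one.
Proof. by rewrite /revI valI0 subr0. Qed.

Lemma revI1 : revI one = zero.
Proof. by rewrite /revI valI1 subrr. Qed.

Lemma revI_continuous : continuous revI.
Proof.
move=> t; apply: (@continuous_at_comp _ _ _ (fun t => 1 - valI t) (@clampI K)).
  by apply: continuousB; [exact: cst_continuous|exact: valI_continuous].
exact: clampI_continuous.
Qed.

Section Reverse.
Variables (x y : X) (a : Path K x y).

Lemma rev_path_continuous : continuous (fun t => a (revI t)).
Proof.
move=> t; apply: (@continuous_at_comp _ _ _ revI a).
  exact: revI_continuous.
exact: cts_fun.
Qed.

Lemma rev_path_zero : a (revI zero) = y.
Proof. by rewrite revI0 path_one. Qed.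

Lemma rev_path_one : a (revI one) = x.
Proof. by rewrite revI1 path_zero. Qed.

Definition rev_path : Path K y x :=
  mk_path rev_path_continuous rev_path_zero rev_path_one.

End Reverse.

(** The square [a (s (1 - t))] has the sides [a], its reverse and two constant
    paths. *)
Lemma transport_rev (R : comUnitRingType) (L : local_system K R X) (x y : X)
    (a : Path K x y) u :
  transport L (rev_path a) (transport L a u) = u.
Proof.
pose Q (st : unitI K * unitI K) := a (clampI (valI st.1 * (1 - valI st.2))).
have aQ : continuous Q.
  move=> st; apply: (@continuous_at_comp _ _ _ (fun st : unitI K * unitI K =>
    clampI (valI st.1 * (1 - valI st.2))) a); last exact: cts_fun.
  apply: (@continuous_at_comp _ _ _ (fun st : unitI K * unitI K =>
    valI st.1 * (1 - valI st.2)) (@clampI K)); last exact: clampI_continuous.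
  apply: continuousM.
    apply: (@continuous_at_comp _ _ _ fst (@valI K)).
      exact: continuous_fst.
    exact: valI_continuous.
  apply: continuousB; first exact: cst_continuous.
  apply: (@continuous_at_comp _ _ _ snd (@valI K)).
    exact: continuous_snd.
  exact: valI_continuous.
rewrite (transport_square (left := cst x) (top := cst x) aQ).
- by rewrite !transport_cst.
- by move=> s; rewrite /Q /= valI0 subr0 mulr1 valIK.
- by move=> t; rewrite /Q /= valI1 mul1r.
- by move=> t; rewrite /Q /= valI0 mul0r path_zero.
- by move=> s; rewrite /Q /= valI1 subrr mulr0 path_zero.
Qed.

End Transport.

(** * Translation loops in an H-space *)

Section HspaceLoop.
Variables (K : realType) (X : topologicalType) (R : comUnitRingType).
Variables (L : local_system K R X).
Variables (m : X * X -> X) (e : X).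
Hypothesis cm : continuous m.
Variables (hl hr : X * unitI K -> X).
Hypotheses (chl : continuous hl) (hl0 : forall x, hl (x, zero) = m (e, x)).
Hypotheses (hl1 : forall x, hl (x, one) = x) (hle : forall t, hl (e, t) = e).
Hypotheses (chr : continuous hr) (hr0 : forall x, hr (x, zero) = m (x, e)).
Hypotheses (hr1 : forall x, hr (x, one) = x) (hre : forall t, hr (e, t) = e).

Definition translate (g : Path K e e) (z : X * unitI K) : X := m (g z.2, z.1).

Lemma translate_continuous g : continuous (translate g).
Proof.
move=> z; apply: (@continuous_at_comp _ _ _
  (fun z : X * unitI K => (g z.2, z.1)) m); last exact: cm.
apply: (@continuous_at_pair _ _ _ (fun z : X * unitI K => g z.2) fst).
  apply: (@continuous_at_comp _ _ _ snd g); first exact: continuous_snd.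
  exact: cts_fun.
exact: continuous_fst.
Qed.

Lemma mulee : m (e, e) = e.
Proof. by rewrite -hl0 hle. Qed.

Definition hl_rev (z : X * unitI K) : X := hl (z.1, revI z.2).

Lemma hl_rev_continuous : continuous hl_rev.
Proof.
move=> z; apply: (@continuous_at_comp _ _ _
  (fun z : X * unitI K => (z.1, revI z.2)) hl); last exact: chl.
apply: (@continuous_at_pair _ _ _ fst (fun z : X * unitI K => revI z.2)).
  exact: continuous_fst.
apply: (@continuous_at_comp _ _ _ snd (@revI K)); first exact: continuous_snd.
exact: revI_continuous.
Qed.

Lemma along_continuous (h : X * unitI K -> X) (x y : X) (a : Path K x y) :
  continuous h -> continuous (fun st : unitI K * unitI K => h (a st.1, st.2)).
Proof.
move=> ch st; apply: (@continuous_at_comp _ _ _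
  (fun st : unitI K * unitI K => (a st.1, st.2)) h); last exact: ch.
apply: (@continuous_at_pair _ _ _ (fun st : unitI K * unitI K => a st.1) snd).
  apply: (@continuous_at_comp _ _ _ fst a); first exact: continuous_fst.
  exact: cts_fun.
exact: continuous_snd.
Qed.

Lemma trace_continuous (h : X * unitI K -> X) (x : X) :
  continuous h -> continuous (fun t => h (x, t)).
Proof.
move=> ch t; apply: (@continuous_at_comp _ _ _ (pair x) h); last exact: ch.
apply: (@continuous_at_pair _ _ _ (cst x) id); last exact: cvg_id.
exact: cst_continuous.
Qed.

Definition trace (h : X * unitI K -> X) (ch : continuous h) (x y z : X)
    (h0 : h (x, zero) = y) (h1 : h (x, one) = z) : Path K y z :=
  mk_path (@trace_continuous h x ch) h0 h1.

Lemma translate0 (g : Path K e e) x : translate g (x, zero) = m (e, x).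
Proof. by rewrite /translate /= path_zero. Qed.

Lemma translate1 (g : Path K e e) x : translate g (x, one) = m (e, x).
Proof. by rewrite /translate /= path_one. Qed.

Lemma hl_rev0 x : hl_rev (x, zero) = x.
Proof. by rewrite /hl_rev /= revI0 hl1. Qed.

Lemma hl_rev1 x : hl_rev (x, one) = m (e, x).
Proof. by rewrite /hl_rev /= revI1 hl0. Qed.

(** The loop run through by [x] during the self-homotopy of the identity that
    deforms the identity to [m (e, -)], translates along [g], and deforms
    back. *)
Definition translation_loop (g : Path K e e) (x : X) : Path K x x :=
  concat (concat (trace hl_rev_continuous (hl_rev0 x) (hl_rev1 x))
                 (trace (@translate_continuous g) (translate0 g x) (translate1 g x)))
         (trace chl (hl0 x) (hl1 x)).

(** Translating a path [b] from [e] to [x] along [g] yields squares which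
    compare the translation loop at [x] with the loop [m (g, e)] at [e],
    and the latter is homotopic to [g]. *)
Lemma transport_translation_loop (g : Path K e e) x (b : Path K e x) u :
  transport L (translation_loop g x) (transport L b u) =
  transport L b (transport L g u).
Proof.
have cb (h : X * unitI K -> X) := @along_continuous h _ _ b.
have cmb : continuous (fun s => m (e, b s)).
  move=> s; apply: (@continuous_at_comp _ _ _ (fun s => (e, b s)) m);
    last exact: cm.
  apply: (@continuous_at_pair _ _ _ (cst e) b); first exact: cst_continuous.
  exact: cts_fun.
have mb0 : m (e, b zero) = e by rewrite path_zero mulee.
have mb1 : m (e, b one) = m (e, x) by rewrite path_one.
pose mb : Path K e (m (e, x)) := mk_path cmb mb0 mb1.
have gm0 : translate g (e, zero) = e by rewrite translate0 mulee.
have gm1 : translate g (e, one) = e by rewrite translate1 mulee.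
pose gm : Path K e e := trace (@translate_continuous g) gm0 gm1.
rewrite /translation_loop transport_concat /= transport_concat /=.
(* One square for each stage; [b] moves to [m (e, b)], stays there and moves
   back, while [e] is fixed, runs through [m (g, e)] and is fixed again. *)
rewrite (transport_square (left := cst e) (top := mb)
           (cb _ hl_rev_continuous)); first last.
- by move=> s; rewrite hl_rev1.
- by move=> t; rewrite path_zero; exact: hle.
- by move=> t; rewrite path_one.
- by move=> s; rewrite hl_rev0.
rewrite transport_cst.
rewrite (transport_square (left := gm) (top := mb)
           (cb _ (@translate_continuous g))); first last.
- by move=> s; rewrite translate1.
- by move=> t; rewrite path_zero.
- by move=> t; rewrite path_one.
- by move=> s; rewrite translate0.
rewrite (transport_square (left := cst e) (top := b) (cb _ chl)); first last.
- by move=> s; rewrite hl1.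
- by move=> t; rewrite path_zero hle.
- by move=> t; rewrite path_one.
- by move=> s; rewrite hl0.
rewrite transport_cst; congr (transport L b _).
(* [m (g, e)] and [g] are the horizontal sides of a square whose vertical sides
   are constant, since the right unit homotopy fixes [e]. *)
rewrite -[LHS](@transport_cst _ _ _ L).
rewrite (transport_square (left := cst e) (top := g)
          (@along_continuous hr _ _ g chr)).
- by rewrite transport_cst.
- by move=> s; rewrite hr0.
- by move=> t; rewrite path_one hre.
- by move=> t; rewrite path_zero hre.
- by move=> s; rewrite hr1.
Qed.

(** Take for [g] the loop [a] conjugated by [b]; transport along [b] turns its
    holonomy back into that of [a]. *)
Lemma holonomy_translation_loop x (b : Path K e x) (a : Path K x x) :
  exists g : Path K e e, holonomy L (translation_loop g x) = holonomy L a.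
Proof.
exists (concat (concat b a) (rev_path b)); rewrite /holonomy.
set g := concat _ _.
suff -> : (transport L (translation_loop g x) : _ -> _) = transport L a by [].
apply/funext => v; have [f _ bf] := @transport_bij _ _ _ L _ _ b.
rewrite -(bf v) transport_translation_loop /g transport_concat /= transport_concat /=.
rewrite -[in LHS](bf (transport L a _)) transport_rev.
by rewrite bf.
Qed.

End HspaceLoop.

(** * Additive maps and alternating sums *)

Lemma morphB0 (V W : zmodType) (f : V -> W) :
  {morph f : x y / x - y} -> f 0 = 0.
Proof. by move=> fB; rewrite -(subrr 0) fB subrr. Qed.

Lemma morphBD (V W : zmodType) (f : V -> W) :
  {morph f : x y / x - y} -> {morph f : x y / x + y}.
Proof.
move=> fB x y; have -> : x + y = x - (0 - y) by rewrite sub0r opprK.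
by rewrite !fB (morphB0 fB) sub0r opprK.
Qed.

Lemma comp_morphB (V W Z : zmodType) (f : V -> W) (g : W -> Z) :
  {morph f : x y / x - y} -> {morph g : x y / x - y} ->
  {morph (fun x => g (f x)) : x y / x - y}.
Proof. by move=> fB gB x y; rewrite fB gB. Qed.

Lemma sub_morphB (V W : zmodType) (f g : V -> W) :
  {morph f : x y / x - y} -> {morph g : x y / x - y} ->
  {morph (fun x => f x - g x) : x y / x - y}.
Proof. by move=> fB gB x y; rewrite fB gB !opprD !opprK addrACA. Qed.

Lemma mulrz_sign (V : zmodType) (x : V) m :
  x *~ (-1) ^+ m = if odd m then - x else x.
Proof. by rewrite -signr_odd; case: odd; rewrite ?mulrN1z ?mulr1z. Qed.

(** The cancellation pattern of the prism operator, with [D i k] the face [k] of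
    the prism simplex [i], and [F i k] the prism simplex [i] of the face [k].
    The two faces [k = i] and [k = i.+1] telescope over [i]; the others are the
    [F i k], with the opposite sign because one index is shifted by one. *)
Lemma alternating_prism_sum (V : zmodType) n (D F : nat -> nat -> V) :
  (forall i k, k < i <= n -> D i k = F i.-1 k)%N ->
  (forall i k, i.+1 < k <= n.+1 -> D i k = F i k.-1)%N ->
  (forall i, i < n -> D i.+1 i.+1 = D i i.+1)%N ->
  \sum_(i < n.+1) \sum_(k < n.+2) D i k *~ (-1) ^+ (i + k) =
  D 0%N 0%N - D n n.+1 -
  \sum_(k < n.+1) \sum_(i < n) F i k *~ (-1) ^+ (i + k).
Proof.
move=> Dlt Dgt Deq; pose d i k := D i k *~ (-1) ^+ (i + k).
pose f i k := F i k *~ (-1) ^+ (i + k).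
have split_row i : (i < n.+1)%N -> \sum_(k < n.+2) d i k =
    (D i i - D i i.+1) +
    (\sum_(0 <= k < i) d i k + \sum_(i.+2 <= k < n.+2) d i k).
  move=> lein; rewrite -(big_mkord xpredT (d i)).
  rewrite (@big_cat_nat _ _ _ i) //=; last lia.
  rewrite [X in _ + X]big_ltn; last lia.
  rewrite [X in _ + (_ + X)]big_ltn; last lia.
  have dE : d i i + d i i.+1 = D i i - D i i.+1.
    by rewrite /d !mulrz_sign addnS addnn /= odd_double.
  by rewrite [d i i + _]addrA dE addrCA.
have low : \sum_(i < n.+1) \sum_(0 <= k < i) d i k =
    - \sum_(i < n) \sum_(0 <= k < i.+1) f i k.
  rewrite big_ord_recl /= big_geq // add0r -sumrN; apply: eq_bigr => i _.
  rewrite /bump /= add1n -sumrN big_nat [RHS]big_nat.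
  apply: eq_bigr => k /andP[_ ki]; rewrite /d /f Dlt /=; last first.
    by rewrite ki ltn_ord.
  by rewrite addSn !mulrz_sign /=; case: odd; rewrite ?opprK.
have high : \sum_(i < n.+1) \sum_(i.+2 <= k < n.+2) d i k =
    - \sum_(i < n) \sum_(i.+1 <= k < n.+1) f i k.
  rewrite big_ord_recr /= [X in _ + X]big_geq // addr0 -sumrN.
  apply: eq_bigr => i _; rewrite big_add1 /= -sumrN big_nat [RHS]big_nat.
  apply: eq_bigr => k /andP[ik kn]; rewrite /d /f Dgt /=; last lia.
  by rewrite addnS !mulrz_sign /=; case: odd; rewrite ?opprK.
have diag : \sum_(i < n.+1) (D i i - D i i.+1) = D 0%N 0%N - D n n.+1.
  rewrite big_ord_recr /= -(big_mkord xpredT (fun j => D j j - D j j.+1)).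
  rewrite (telescope_sumr_eq (fun j => - D j j)) //; last first.
    by move=> j /andP[_ /Deq <-]; rewrite opprK addrC.
  by rewrite opprK [- _ + _]addrC addrA subrK.
transitivity (\sum_(i < n.+1) \sum_(k < n.+2) d i k) => //.
rewrite (eq_bigr _ (fun (i : 'I_n.+1) _ => split_row i (ltn_ord i))) big_split /=.
rewrite diag big_split /= low high -opprD -big_split /= exchange_big /=.
congr (_ - _); apply: eq_bigr => i _.
rewrite -(@big_cat_nat _ _ _ i.+1) //=; last by have := ltn_ord i; lia.
by rewrite big_mkord.
Qed.

HB.instance Definition _ (T : choiceType) (V : zmodType) (f : T -> V) :=
  GRing.isZmodMorphism.Build {freeg T} V (freeg_ext f) (freeg_extB f).

Lemma freeg_morph_eq (T : choiceType) (V : zmodType) (f g : {freeg T} -> V) :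
  {morph f : c d / c - d} -> {morph g : c d / c - d} ->
  (forall x, f << x >> = g << x >>) -> f =1 g.
Proof.
move=> fB gB fg c.
pose fz := GRing.isZmodMorphism.Build _ _ f fB.
pose gz := GRing.isZmodMorphism.Build _ _ g gB.
pose fA : {additive {freeg T} -> V} := HB.pack f fz.
pose gA : {additive {freeg T} -> V} := HB.pack g gz.
rewrite -[c]freeg_sumE -[f]/(fA : _ -> _) -[g]/(gA : _ -> _) !raddf_sum.
apply: eq_bigr => x _.
rewrite -[coeff x c]intz -freegU_mulz !raddfMz /=.
by congr (_ *~ _); exact: fg.
Qed.

(** * Affine maps between standard simplices *)

Section IndexMaps.
Variable K : realType.

(** The affine map between standard simplices that sends each vertex [j] to
    the vertex [th j]; the faces and degeneracies are instances. *)
Definition push_fun m n (th : 'I_m.+1 -> 'I_n.+1) (x : 'rV[K]_m.+1) :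
    'rV[K]_n.+1 :=
  \row_k \sum_(j | th j == k) x 0 j.

Lemma push_sum m n (th : 'I_m.+1 -> 'I_n.+1) (x : 'rV[K]_m.+1)
    (P : pred 'I_n.+1) :
  \sum_(k | P k) push_fun th x 0 k = \sum_(j | P (th j)) x 0 j.
Proof.
rewrite [RHS](partition_big th P) //; apply: eq_bigr => k Pk.
rewrite mxE; apply: eq_bigl => j.
by case: eqP => [->|]; rewrite ?Pk ?andbF.
Qed.

Lemma push_subproof m n (th : 'I_m.+1 -> 'I_n.+1) (x : @simplex K m) :
  push_fun th (set_val x) \in @simplex K n.
Proof.
have [x0 x1] := set_mem (valP x); apply/mem_set; split.
  by move=> k; rewrite mxE sumr_ge0.
by rewrite (push_sum th _ xpredT).
Qed.

Definition push m n (th : 'I_m.+1 -> 'I_n.+1) (x : @simplex K m) : @simplex K n :=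
  exist (fun y => y \in @simplex K n) _ (push_subproof th x).

Definition weight m (ch : pred 'I_m.+1) (x : @simplex K m) : K :=
  \sum_(j | ch j) set_val x 0 j.

Lemma weight_push m n (th : 'I_m.+1 -> 'I_n.+1) ch x :
  weight ch (push th x) = weight (ch \o th) x.
Proof. exact: push_sum. Qed.

Lemma simplex_eq n (x y : @simplex K n) :
  (forall k, set_val x 0 k = set_val y 0 k) -> x = y.
Proof.
move=> xy; apply: val_inj; apply/rowP => k; exact: xy.
Qed.

Lemma push_comp l m n (th : 'I_m.+1 -> 'I_n.+1) (th' : 'I_l.+1 -> 'I_m.+1) x :
  push th (push th' x) = push (th \o th') x.
Proof.
by apply: simplex_eq => k; rewrite /= !mxE (push_sum _ _ (fun j => th j == k)).
Qed.

Lemma push_id n : push (@id 'I_n.+1) =1 id.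
Proof.
by move=> x; apply: simplex_eq => k; rewrite /= mxE big_pred1_eq.
Qed.

Lemma face_push n (k : 'I_n.+2) : face k =1 push (fintype.lift k).
Proof.
move=> x; apply: simplex_eq => j; rewrite /= !mxE.
case: unliftP => [i ->|->].
  by rewrite (big_pred1 i) // => i'; rewrite (inj_eq lift_inj).
by rewrite big_pred0 // => i; rewrite eq_sym (negPf (neq_lift _ _)).
Qed.

Lemma sum_continuous (T : topologicalType) I (r : seq I) (P : pred I)
    (F : I -> T -> K) :
  (forall i, P i -> continuous (F i)) ->
  continuous (fun x => \sum_(i <- r | P i) F i x).
Proof. by apply: continuous_big; exact: add_continuous. Qed.

Lemma coord_simplex_continuous n k :
  continuous (fun x : @simplex K n => set_val x 0 k).
Proof.
move=> x; apply: (@continuous_comp _ _ _ set_val (fun z : 'rV[K]_n.+1 => z 0 k)).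
  exact: initial_continuous.
exact: coord_continuous.
Qed.

Lemma push_continuous m n (th : 'I_m.+1 -> 'I_n.+1) : continuous (push th).
Proof.
apply: continuous_comp_initial => x A /= [P nP PA].
suff h : \forall y \near x, forall k, P 0 k (push_fun th (set_val y) 0 k).
  suff : nbhs x ((set_val \o push th) @^-1` A) by [].
  by apply: filterS h => y Py; apply: PA => r j; rewrite (ord1 r); exact: Py.
apply: (@filter_forall _ 'I_n.+1
  (fun k (y : @simplex K m) => P 0 k (push_fun th (set_val y) 0 k)) (nbhs x)) => k.
suff ck : continuous (fun y : @simplex K m => push_fun th (set_val y) 0 k).
  exact: (ck x) (nP 0 k).
under [X in continuous X]funext => y do rewrite mxE.
by apply: sum_continuous => i _; exact: coord_simplex_continuous.
Qed.

Lemma weight_continuous m (ch : pred 'I_m.+1) : continuous (weight ch).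
Proof. by apply: sum_continuous => i _; exact: coord_simplex_continuous. Qed.

End IndexMaps.

(** * Singular chains and the prism operator *)

Section ChainMaps.
Variable K : realType.

HB.instance Definition _ n (X : topologicalType) :=
  GRing.isZmodMorphism.Build _ _ (@boundary K n X) (freeg_extB _).

HB.instance Definition _ n (X Y : topologicalType) (f : continuousType X Y) :=
  GRing.isZmodMorphism.Build _ _ (@chain_map K n X Y f) (freeg_extB _).

Lemma boundaryB n (X : topologicalType) :
  {morph @boundary K n X : c d / c - d}.
Proof. exact: freeg_extB. Qed.

Lemma chain_mapB n (X Y : topologicalType) (f : continuousType X Y) :
  {morph @chain_map K n X Y f : c d / c - d}.
Proof. exact: freeg_extB. Qed.

Lemma boundary_gen n (X : topologicalType) (s : sing K n.+1 X) :
  boundary << s >> = \sum_(i < n.+2) << (s \o face i : sing K n X) >> *~ (-1) ^+ i.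
Proof.
rewrite /boundary freeg_extU; apply: eq_bigr => i _.
by rewrite freegU_mulz intz.
Qed.

Lemma chain_map_gen n (X Y : topologicalType) (f : continuousType X Y)
    (s : sing K n X) : chain_map f << s >> = << (f \o s : sing K n Y) >>.
Proof. exact: freeg_extU. Qed.

Lemma chain_map_boundary n (X Y : topologicalType) (f : continuousType X Y)
    (c : chain K n.+1 X) :
  boundary (chain_map f c) = chain_map f (boundary c).
Proof.
apply: (freeg_morph_eq (f := fun c => boundary (chain_map f c))
          (g := fun c => chain_map f (boundary c))).
- exact: comp_morphB (chain_mapB f) (@boundaryB _ _).
- exact: comp_morphB (@boundaryB _ _) (chain_mapB f).
move=> s; rewrite chain_map_gen !boundary_gen raddf_sum.
apply: eq_bigr => i _; rewrite raddfMz /= chain_map_gen.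
by congr (<< _ >> *~ _); apply/continuousEP.
Qed.

Lemma chain_map_id n (X : topologicalType) (f : continuousType X X)
    (c : chain K n X) : f =1 id -> chain_map f c = c.
Proof.
move=> f1; apply: (freeg_morph_eq (f := @chain_map K n X X f) (g := id)) => //.
  by move=> a b; rewrite raddfB.
by move=> s; rewrite chain_map_gen; congr << _ >>; apply/continuousEP => x /=.
Qed.

End ChainMaps.

Section Prism.
Variables (K : realType) (E W : topologicalType) (H : E * unitI K -> W).
Hypothesis cH : continuous H.

Lemma prism_simplex_subproof m n (s : sing K n E) (th : 'I_m.+1 -> 'I_n.+1)
    (ch : pred 'I_m.+1) :
  continuous (fun x : @simplex K m => H (s (push th x), clampI (weight ch x))).
Proof.
move=> x; apply: (@continuous_at_comp _ _ _
  (fun x => (s (push th x), clampI (weight ch x))) H); last exact: cH.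
apply: (@continuous_at_pair _ _ _ (fun x => s (push th x))
  (fun x => clampI (weight ch x))).
  apply: (@continuous_at_comp _ _ _ (push th) s); first exact: push_continuous.
  exact: cts_fun.
apply: (@continuous_at_comp _ _ _ (weight ch) (@clampI K)).
  exact: weight_continuous.
exact: clampI_continuous.
Qed.

(** The simplex of [W] whose vertex [j] lies over the vertex [th j] of [s], at
    the end of the homotopy if [ch j] and at its start otherwise.  The prism
    simplices and all their faces have this form, so the identities between
    them reduce to identities between index maps. *)
Definition prism_simplex m n (s : sing K n E) (th : 'I_m.+1 -> 'I_n.+1)
    (ch : pred 'I_m.+1) : sing K m W :=
  mkcts (@prism_simplex_subproof m n s th ch).

Lemma eq_prism_simplex m n (s : sing K n E) th th' (ch ch' : pred 'I_m.+1) :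
  th =1 th' -> ch =1 ch' -> prism_simplex s th ch = prism_simplex s th' ch'.
Proof. by move=> /funext -> /funext ->. Qed.

Lemma prism_simplex_face m n (s : sing K n E) (th : 'I_m.+2 -> 'I_n.+1) ch k :
  (prism_simplex s th ch \o face k : sing K m W) =
  prism_simplex s (th \o fintype.lift k) (ch \o fintype.lift k).
Proof.
apply/continuousEP => x /=; rewrite /mkcts face_push.
by rewrite push_comp weight_push.
Qed.

Lemma prism_simplex_of_face m n (s : sing K n.+1 E) (th : 'I_m.+1 -> 'I_n.+1)
    ch k :
  prism_simplex (s \o face k : sing K n E) th ch =
  prism_simplex s (fintype.lift k \o th) ch.
Proof.
by apply/continuousEP => x /=; rewrite /mkcts /= face_push push_comp.
Qed.

(** The prism over [s] is cut into the simplices whose first vertices, up to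
    [i], run along the bottom and whose last ones, again from [i], run along
    the top. *)
Definition prism n : chain K n E -> chain K n.+1 W :=
  freeg_ext (fun s : sing K n E => \sum_(i < n.+1)
    << prism_simplex s (fun l : 'I_n.+2 => inord (unbump i l))
         (fun l : 'I_n.+2 => (i < l)%N) >> *~ (-1) ^+ i).

HB.instance Definition _ n :=
  GRing.isZmodMorphism.Build _ _ (@prism n) (freeg_extB _).

Lemma prismB n : {morph @prism n : c d / c - d}.
Proof. exact: freeg_extB. Qed.

Variables F0 F1 : continuousType E W.
Hypothesis H0 : forall x, H (x, zero) = F0 x.
Hypothesis H1 : forall x, H (x, one) = F1 x.

Lemma prism_simplex_start n (s : sing K n E) (ch : pred 'I_n.+1) :
  ch =1 xpred0 -> prism_simplex s id ch = (F0 \o s : sing K n W).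
Proof.
move=> ch0; apply/continuousEP => x /=; rewrite /mkcts push_id /weight.
by rewrite (eq_bigl _ _ ch0) big_pred0_eq; exact: H0.
Qed.

Lemma prism_simplex_end n (s : sing K n E) (ch : pred 'I_n.+1) :
  ch =1 xpredT -> prism_simplex s id ch = (F1 \o s : sing K n W).
Proof.
move=> ch1; apply/continuousEP => x /=; rewrite /mkcts push_id /weight.
rewrite (eq_bigl _ _ ch1) (set_mem (valP x)).2; exact: H1.
Qed.

Lemma boundary_prism_gen n (s : sing K n E) :
  boundary (prism << s >>) = << (F1 \o s : sing K n W) >>
    - << (F0 \o s : sing K n W) >>
    - \sum_(k < n.+1) \sum_(i < n)
        << prism_simplex s (fun l : 'I_n.+1 => inord (bump k (unbump i l)))
             (fun l : 'I_n.+1 => (i < l)%N) >> *~ (-1) ^+ (i + k).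
Proof.
pose D i k : chain K n W :=
  << prism_simplex s (fun l : 'I_n.+1 => inord (unbump i (bump k l)))
       (fun l : 'I_n.+1 => (i < bump k l)%N) >>.
pose F i k : chain K n W :=
  << prism_simplex s (fun l : 'I_n.+1 => inord (bump k (unbump i l)))
       (fun l : 'I_n.+1 => (i < l)%N) >>.
have -> : boundary (prism << s >>) =
    \sum_(i < n.+1) \sum_(k < n.+2) D i k *~ (-1) ^+ (i + k).
  rewrite /prism freeg_extU raddf_sum; apply: eq_bigr => i _.
  rewrite raddfMz /= boundary_gen mulrz_suml; apply: eq_bigr => k _.
  by rewrite prism_simplex_face -mulrzA exprD mulrC.
rewrite (@alternating_prism_sum _ n D F).
- congr (<< _ >> - << _ >> - _).
  + rewrite -(prism_simplex_end s (ch := xpredT)) //.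
    apply: eq_prism_simplex => // l; rewrite -[RHS]inord_val; congr inord.
    by rewrite /unbump /bump /=; lia.
  + rewrite -(prism_simplex_start s (ch := xpred0)) //.
    apply: eq_prism_simplex => l; have := ltn_ord l; last first.
      by rewrite /bump /=; lia.
    move=> ln; rewrite -[RHS]inord_val; congr inord.
    by rewrite /unbump /bump; lia.
- move=> i k ki; congr << _ >>.
  apply: eq_prism_simplex => l; first congr inord; rewrite /unbump /bump; lia.
- move=> i k ki; congr << _ >>.
  apply: eq_prism_simplex => l; first congr inord; rewrite /unbump /bump; lia.
- move=> i ni; congr << _ >>.
  apply: eq_prism_simplex => l; first congr inord; rewrite /unbump /bump; lia.
Qed.

(** In degree 0 there is no [prism (boundary c)] term, hence the separate
    statement. *)
Lemma boundary_prism0 (c : chain K 0 E) :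
  boundary (prism c) = chain_map F1 c - chain_map F0 c.
Proof.
apply: (freeg_morph_eq (f := fun c => boundary (prism c))
          (g := fun c => chain_map F1 c - chain_map F0 c)).
- exact: comp_morphB (@prismB _) (@boundaryB _ _ _).
- exact: sub_morphB (chain_mapB F1) (chain_mapB F0).
move=> s; rewrite boundary_prism_gen !chain_map_gen.
by rewrite [X in _ - X]big1 ?subr0 // => k _; rewrite big_ord0.
Qed.

Lemma boundary_prismS n (c : chain K n.+1 E) :
  boundary (prism c) = chain_map F1 c - chain_map F0 c - prism (boundary c).
Proof.
apply: (freeg_morph_eq (f := fun c => boundary (prism c))
          (g := fun c => chain_map F1 c - chain_map F0 c - prism (boundary c))).
- exact: comp_morphB (@prismB _) (@boundaryB _ _ _).
- apply: sub_morphB; last exact: comp_morphB (@boundaryB _ _ _) (@prismB _).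
  exact: sub_morphB (chain_mapB F1) (chain_mapB F0).
move=> s; rewrite boundary_prism_gen !chain_map_gen boundary_gen; congr (_ - _).
rewrite raddf_sum; apply: eq_bigr => k _.
rewrite raddfMz /= /prism freeg_extU mulrz_suml; apply: eq_bigr => i _.
rewrite -mulrzA exprD mulrC; congr (<< _ >> *~ _).
rewrite prism_simplex_of_face; apply: eq_prism_simplex => // l /=.
apply: val_inj; rewrite /= inordK; last first.
  by have := ltn_ord i; have := ltn_ord l; rewrite /bump /unbump; lia.
by rewrite inordK //; have := ltn_ord i; have := ltn_ord l; rewrite /unbump; lia.
Qed.

End Prism.

Lemma prism_chain_map (K : realType) (E W : topologicalType)
    (H : E * unitI K -> W) (cH : continuous H) (d : continuousType E E)
    (d' : continuousType W W) n (c : chain K n E) :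
  (forall x t, H (d x, t) = d' (H (x, t))) ->
  prism cH (chain_map d c) = chain_map d' (prism cH c).
Proof.
move=> Hd; apply: (freeg_morph_eq (f := fun c => prism cH (chain_map d c))
          (g := fun c => chain_map d' (prism cH c))).
- exact: comp_morphB (chain_mapB d) (prismB cH (n := n)).
- exact: comp_morphB (prismB cH (n := n)) (chain_mapB d').
move=> s; rewrite chain_map_gen /prism !freeg_extU raddf_sum.
apply: eq_bigr => i _; rewrite raddfMz /= chain_map_gen.
by congr (<< _ >> *~ _); apply/continuousEP => x /=; rewrite /mkcts /= Hd.
Qed.

(** * Tensor products *)

Section TensorLift.
Variables (Pi : Type) (A B : zmodType) (actA : Pi -> A -> A) (actB : Pi -> B -> B).

Lemma tensor_morph_eq (V : zmodType) (f g : tensor actA actB -> V) :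
  {morph f : x y / x - y} -> {morph g : x y / x - y} ->
  (forall a b, f (tens actA actB a b) = g (tens actA actB a b)) -> f =1 g.
Proof.
move=> fB gB fg t; rewrite -[t]reprK.
apply: (freeg_morph_eq
  (f := fun u => f (\pi_(Quotient.quot (tensor_null actA actB)) u)%qT)
  (g := fun u => g (\pi_(Quotient.quot (tensor_null actA actB)) u)%qT)).
- by move=> u v; rewrite raddfB; exact: fB.
- by move=> u v; rewrite raddfB; exact: gB.
by move=> [a b]; exact: fg.
Qed.

Variables (V : zmodType) (F : A -> B -> V).

Definition tensor_lift (t : tensor actA actB) : V :=
  freeg_ext (fun p : A * B => F p.1 p.2)
    (repr (t : Quotient.quot (tensor_null actA actB))).

Hypothesis FDl : forall a a' b, F (a + a') b = F a b + F a' b.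
Hypothesis FDr : forall a b b', F a (b + b') = F a b + F a b'.
Hypothesis F_act : forall g a b, F (actA g a) b = F a (actB g b).

Lemma tensor_lift_pi (u : {freeg (A * B)%type}) :
  tensor_lift (\pi_(Quotient.quot (tensor_null actA actB)) u)%qT =
  freeg_ext (fun p : A * B => F p.1 p.2) u.
Proof.
rewrite /tensor_lift; set G := fun p => _; set v := repr _.
suff h w : tensor_rel actA actB w -> freeg_ext G w = 0.
  apply/eqP; rewrite -subr_eq0 -freeg_extB; apply/eqP/h/asboolP.
  have := Quotient.idealrBE (tensor_null actA actB) v u.
  by rewrite reprK eqxx.
elim=> [a a' b|a b b'|g a b||w1 w2 _ h1 _ h2].
- by rewrite !freeg_extB !freeg_extU /G /= FDl -addrA -opprD subrr.
- by rewrite !freeg_extB !freeg_extU /G /= FDr -addrA -opprD subrr.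
- by rewrite freeg_extB !freeg_extU /G /= F_act subrr.
- exact: raddf0.
- by rewrite freeg_extB h1 h2 subrr.
Qed.

Lemma tensor_lift_tens a b : tensor_lift (tens actA actB a b) = F a b.
Proof. by rewrite tensor_lift_pi freeg_extU. Qed.

Lemma tensor_liftB : {morph tensor_lift : t u / t - u}.
Proof.
move=> t u; rewrite -[t]reprK -[u]reprK.
by rewrite -[X in tensor_lift X]raddfB !tensor_lift_pi freeg_extB.
Qed.

End TensorLift.

(** * Twisted chains *)

Section TwistedChains.
Variables (K : realType) (R : comUnitRingType) (X : topologicalType) (x0 : X).
Variables (U : universal_cover K x0) (L : local_system K R X).

Let twc n := twisted_chain U L n.
Let ctens n (c : chain K n U) (r : R) : twc n :=
  tens (fun a : Path K x0 x0 => @chain_map K n U U (deck U a))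
       (fun (a : Path K x0 x0) (r : R) => holonomy L a * r) c r.

Definition deck_equivariant (F : U -> U) : Prop :=
  forall (a : Path K x0 x0) x, F (deck U a x) = deck U a (F x).

Lemma twisted_boundary_tens n c r :
  twisted_boundary (ctens (n := n.+1) c r) = ctens (boundary c) r.
Proof.
apply: tensor_mapE; first exact: raddfD.
by move=> a x; exact: chain_map_boundary.
Qed.

Lemma twisted_boundaryB n :
  {morph @twisted_boundary K R X x0 U L n : x y / x - y}.
Proof.
apply: tensor_mapB; first exact: raddfD.
by move=> a x; exact: chain_map_boundary.
Qed.

Definition twisted_map (F : continuousType U U) n : twc n -> twc n :=
  @tensor_map _ _ _ _ _ _ _ (@chain_map K n U U F).

Lemma chain_map_equivariant (F : continuousType U U) n (a : Path K x0 x0)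
    (c : chain K n U) : deck_equivariant F ->
  chain_map F (chain_map (deck U a) c) = chain_map (deck U a) (chain_map F c).
Proof.
move=> eF; apply: (freeg_morph_eq
  (f := fun c => chain_map F (chain_map (deck U a) c))
  (g := fun c => chain_map (deck U a) (chain_map F c))).
- exact: comp_morphB (chain_mapB _) (chain_mapB F).
- exact: comp_morphB (chain_mapB F) (chain_mapB _).
move=> s; rewrite !chain_map_gen; congr << _ >>.
by apply/continuousEP => x /=; exact: eF.
Qed.

Lemma twisted_map_tens (F : continuousType U U) n c r : deck_equivariant F ->
  twisted_map F (ctens (n := n) c r) = ctens (chain_map F c) r.
Proof.
move=> eF; apply: tensor_mapE; first exact: raddfD.
by move=> a x; exact: chain_map_equivariant.
Qed.

Lemma twisted_mapB (F : continuousType U U) n : deck_equivariant F ->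
  {morph @twisted_map F n : x y / x - y}.
Proof.
move=> eF; apply: tensor_mapB; first exact: raddfD.
by move=> a x; exact: chain_map_equivariant.
Qed.

Lemma twisted_map_id n (z : twc n) : twisted_map idfun z = z.
Proof.
apply: (tensor_morph_eq (f := @twisted_map idfun n) (g := id)) => //.
  exact: twisted_mapB.
move=> c r; rewrite -/(ctens c r) twisted_map_tens //; congr ctens.
exact: chain_map_id.
Qed.

(** Multiplication by the scalar [q], which acts on the second factor. *)
Definition twisted_scale n (q : R) : twc n -> twc n :=
  tensor_lift (fun c r => ctens c (q * r)).

Lemma twisted_scale_balanced n q :
  [/\ forall c c' r, ctens (n := n) (c + c') (q * r) = ctens c (q * r) + ctens c' (q * r),
      forall c r r', ctens (n := n) c (q * (r + r')) = ctens c (q * r) + ctens c (q * r')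
    & forall (a : Path K x0 x0) c r,
        ctens (n := n) (chain_map (deck U a) c) (q * r) =
        ctens c (q * (holonomy L a * r))].
Proof.
split=> [c c' r|c r r'|a c r].
- exact: tensDl.
- by rewrite mulrDr; exact: tensDr.
by rewrite mulrCA; exact: tens_act.
Qed.

Lemma twisted_scale_tens n q c r :
  twisted_scale q (ctens (n := n) c r) = ctens c (q * r).
Proof.
by have [? ? ?] := twisted_scale_balanced n q; exact: tensor_lift_tens.
Qed.

Lemma twisted_scaleB n q : {morph @twisted_scale n q : x y / x - y}.
Proof. by have [? ? ?] := twisted_scale_balanced n q; exact: tensor_liftB. Qed.

Lemma ctensBr n c r r' : ctens (n := n) c (r - r') = ctens c r - ctens c r'.
Proof. by apply/eqP; rewrite eq_sym subr_eq -[X in _ == X]tensDr subrK. Qed.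

Lemma twisted_scaleB1 n q (z : twc n) :
  twisted_scale (q - 1) z = twisted_scale q z - z.
Proof.
apply: (tensor_morph_eq (f := @twisted_scale n (q - 1))
  (g := fun z => twisted_scale q z - z)).
- exact: twisted_scaleB.
- by apply: (@sub_morphB _ _ _ id) => //; exact: twisted_scaleB.
move=> c r; rewrite -/(ctens c r) !twisted_scale_tens mulrBl mul1r.
exact: ctensBr.
Qed.

Lemma twisted_scaleK n q (z : twc n) : q \is a GRing.unit ->
  twisted_scale q^-1 (twisted_scale q z) = z.
Proof.
move=> uq; apply: (tensor_morph_eq
  (f := fun z => twisted_scale q^-1 (twisted_scale q z)) (g := id)) => //.
  exact: comp_morphB (@twisted_scaleB n q) (@twisted_scaleB n q^-1).
by move=> c r; rewrite -/(ctens c r) !twisted_scale_tens mulKr.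
Qed.

Lemma twisted_boundary_scale n q (z : twc n.+1) :
  twisted_boundary (twisted_scale q z) = twisted_scale q (twisted_boundary z).
Proof.
apply: (tensor_morph_eq
  (f := fun z : twc n.+1 => twisted_boundary (twisted_scale q z))
  (g := fun z => twisted_scale q (twisted_boundary z))).
- exact: comp_morphB (@twisted_scaleB _ q) (@twisted_boundaryB n).
- exact: comp_morphB (@twisted_boundaryB n) (@twisted_scaleB _ q).
move=> c r; rewrite -/(ctens c r).
by rewrite twisted_scale_tens !twisted_boundary_tens twisted_scale_tens.
Qed.

(** By the defining relation of the tensor product over the group ring. *)
Lemma twisted_map_deck n (a : Path K x0 x0) (z : twc n) :
  deck_equivariant (deck U a) ->
  twisted_map (deck U a) z = twisted_scale (holonomy L a) z.
Proof.
move=> ea; apply: (tensor_morph_eq (f := @twisted_map (deck U a) n)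
  (g := @twisted_scale n (holonomy L a))).
- exact: twisted_mapB.
- exact: twisted_scaleB.
move=> c r; rewrite -/(ctens c r) twisted_map_tens // twisted_scale_tens.
exact: tens_act.
Qed.

(** * Equivariant homotopies of the universal cover *)

Section Homotopy.
Variables (H : U * unitI K -> U) (F0 F1 : continuousType U U).
Hypothesis cH : continuous H.
Hypothesis H0 : forall x, H (x, zero) = F0 x.
Hypothesis H1 : forall x, H (x, one) = F1 x.
Hypothesis eH : forall a x t, H (deck U a x, t) = deck U a (H (x, t)).

Let eF0 : deck_equivariant F0. Proof. by move=> a x; rewrite -!H0 eH. Qed.
Let eF1 : deck_equivariant F1. Proof. by move=> a x; rewrite -!H1 eH. Qed.

Definition twisted_prism n : twc n -> twc n.+1 :=
  @tensor_map _ _ _ _ _ _ _ (@prism K U U H cH n).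

Lemma twisted_prism_tens n c r :
  twisted_prism (ctens (n := n) c r) = ctens (prism cH c) r.
Proof.
apply: tensor_mapE; first exact: raddfD.
by move=> a x; apply: prism_chain_map => y t; exact: eH.
Qed.

Lemma twisted_prismB n : {morph @twisted_prism n : x y / x - y}.
Proof.
apply: tensor_mapB; first exact: raddfD.
by move=> a x; apply: prism_chain_map => y t; exact: eH.
Qed.

Lemma ctensBl n c c' r : ctens (n := n) (c - c') r = ctens c r - ctens c' r.
Proof. by apply/eqP; rewrite eq_sym subr_eq -[X in _ == X]tensDl subrK. Qed.

Lemma twisted_homotopy n (z : twc n) : twisted_cycle z ->
  exists w : twc n.+1, twisted_boundary w = twisted_map F1 z - twisted_map F0 z.
Proof.
case: n z => [|n] z zc; exists (twisted_prism z).
  apply: (tensor_morph_eq (f := fun z : twc 0 => twisted_boundary (twisted_prism z))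
    (g := fun z => twisted_map F1 z - twisted_map F0 z)).
  - exact: comp_morphB (@twisted_prismB 0) (@twisted_boundaryB 0).
  - exact: sub_morphB (twisted_mapB eF1) (twisted_mapB eF0).
  move=> c r; rewrite -/(ctens c r) twisted_prism_tens twisted_boundary_tens.
  by rewrite !twisted_map_tens // (boundary_prism0 cH H0 H1) ctensBl.
rewrite -[RHS]subr0 -(morphB0 (@twisted_prismB n)) -[in RHS]zc.
apply: (tensor_morph_eq (f := fun z : twc n.+1 => twisted_boundary (twisted_prism z))
  (g := fun z => twisted_map F1 z - twisted_map F0 z
                 - twisted_prism (twisted_boundary z))).
- exact: comp_morphB (@twisted_prismB n.+1) (@twisted_boundaryB n.+1).
- apply: sub_morphB; last exact: comp_morphB (@twisted_boundaryB n) (@twisted_prismB n).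
  exact: sub_morphB (twisted_mapB eF1) (twisted_mapB eF0).
move=> c r; rewrite -/(ctens c r) twisted_prism_tens !twisted_boundary_tens.
by rewrite !twisted_map_tens // twisted_prism_tens (boundary_prismS cH H0 H1) !ctensBl.
Qed.

End Homotopy.

(** [h] lifts to a homotopy of the cover that starts at [F]; its end [G] again
    commutes with the deck transformations, so that homotopies can be lifted
    one after the other.  The path [b] records where the base point goes, which
    is what identifies the final map as a deck transformation. *)
Lemma lifted_homotopy (h : X * unitI K -> X) (F : continuousType U U) :
  continuous h -> deck_equivariant F ->
  (forall x, h (cover_map x, zero) = cover_map (F x)) ->
  exists G : continuousType U U, [/\ deck_equivariant G,
    forall x, cover_map (G x) = h (cover_map x, one),
    exists b : Path K (F (cover_base U)) (G (cover_base U)),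
      forall t, cover_map (b t) = h (x0, t)
  & forall n (z : twc n), twisted_cycle z -> exists w : twc n.+1,
      twisted_boundary w = twisted_map G z - twisted_map F z].
Proof.
move=> ch eF hF; have cp := cover_covering U.
have twc' : continuous (fun z : U * unitI K => h (cover_map z.1, z.2)).
  move=> z; apply: (@continuous_at_comp _ _ _
    (fun z : U * unitI K => (cover_map z.1, z.2)) h); last exact: ch.
  apply: (@continuous_at_pair _ _ _ (fun z : U * unitI K => cover_map z.1) snd).
    apply: (@continuous_at_comp _ _ _ fst (@cover_map _ _ _ U)).
      exact: continuous_fst.
    exact: cp.1.
  exact: continuous_snd.
have [H [cH pH H0]] := homotopy_lifting cp twc' (@cts_fun _ _ F)
  (fun x => esym (hF x)).
have cHx x : continuous (fun t => H (x, t)) by exact: trace_continuous.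
have eH a x t : H (deck U a x, t) = deck U a (H (x, t)).
  apply: (lift_unique cp (f := fun t => H (deck U a x, t))
           (g := fun t => deck U a (H (x, t)))) => //.
  - move=> u; apply: (@continuous_at_comp _ _ _ (fun t => H (x, t)) (deck U a)).
      exact: cHx.
    exact: cts_fun.
  - by move=> u; rewrite deck_over !pH /= deck_over.
  - by rewrite !H0 eF.
have cG : continuous (fun x => H (x, one)).
  move=> x; apply: (@continuous_at_comp _ _ _ (fun x => (x, one)) H).
    apply: (@continuous_at_pair _ _ _ id (cst one)); first exact: cvg_id.
    exact: cst_continuous.
  exact: cH.
exists (mkcts cG); split.
- by move=> a x; exact: eH.
- by move=> x; exact: pH.
- exists (mk_path (cHx (cover_base U)) (H0 _) erefl) => t.
  by rewrite /mk_path /= pH /= cover_map_base.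
- by move=> n z; apply: (twisted_homotopy (H := H)).
Qed.

(** Two lifts of the projection that agree at the base point agree along every
    path from it. *)
Lemma deck_unique (a : Path K x0 x0) (F : continuousType U U) :
  (forall x, cover_map (F x) = cover_map x) ->
  F (cover_base U) = deck U a (cover_base U) -> F = deck U a.
Proof.
move=> pF Fb; apply/continuousEP => x.
have [b] := (cover_simply_connected U).1 (cover_base U) x.
have lift := lift_unique (cover_covering U) (f := F \o b) (g := deck U a \o b).
rewrite -(path_one (s := b)); apply: lift.
- exact: cts_fun.
- exact: cts_fun.
- by move=> t /=; rewrite pF deck_over.
- by rewrite /= path_zero.
Qed.

End TwistedChains.

(** * Twisted homology of H-spaces *)

Theorem proposition4 (K : realType) (X : topologicalType) (x0 : X)
    (X_connected : path_connected K X) (U : universal_cover K x0)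
    (H : exists (R : comUnitRingType) (G : {pred R}) (L : local_system K R X),
      [/\ unit_subgroup G,
          forall g, g \in G -> g <> 1 -> 1 - g \is a GRing.unit,
          rank_one L /\ local_system_in G L,
          nontrivial L x0
        & homology_nonzero U L]) :
  ~ exists (m : X * X -> X) (e : X), is_Hspace K m e.
Proof.
move=> [m [e [cm [hl [chl hl0 hl1 hle]] [hr [chr hr0 hr1 hre]] _]]].
have [R [G [L [_ unitG [_ holG] [a hola] [n [z [zc zn0]]]]]]] := H.
have [b] := X_connected e x0.
have [g holg] := holonomy_translation_loop L cm chl hl0 hl1 hle chr hr0 hr1 hre b a.
set c := translation_loop _ _ _ _ g x0 in holg.
(* The three stages of the self-homotopy of the identity are lifted in turn. *)
have [A [eA pA [bA pbA] hA]] :=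
  @lifted_homotopy K R X x0 U L _ idfun (hl_rev_continuous chl) (fun _ _ => erefl)
    (fun x => hl_rev0 hl1 (cover_map x)).
have [B [eB pB [bB pbB] hB]] :=
  @lifted_homotopy K R X x0 U L _ A (@translate_continuous _ _ _ _ cm g) eA
    (fun x => etrans (translate0 m g (cover_map x)) (esym (etrans (pA x) (hl_rev1 hl0 _)))).
have [C [eC pC [bC pbC] hC]] :=
  @lifted_homotopy K R X x0 U L _ B chl eB
    (fun x => etrans (hl0 (cover_map x)) (esym (etrans (pB x) (translate1 m g _)))).
have CE : C = deck U c.
  apply: deck_unique => [x|]; first by rewrite pC hl1.
  symmetry; apply: (deck_base (b := concat (concat bA bB) bC)) => t.
  rewrite /c /translation_loop [in LHS]concatE [in RHS]concatE.
  case: ifP => _; last by rewrite pbC.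
  by rewrite [in LHS]concatE [in RHS]concatE; case: ifP => _; rewrite ?pbA ?pbB.
have [wA dA] := hA n z zc; have [wB dB] := hB n z zc; have [wC dC] := hC n z zc.
have ec : deck_equivariant (deck U c) by rewrite -CE.
have u1 : holonomy L a - 1 \is a GRing.unit.
  by rewrite -unitrN opprB; apply: unitG => //; exact: holG.
have bD := morphBD (@twisted_boundaryB _ _ _ _ U L n).
have dw : twisted_boundary (wC + (wB + wA)) = twisted_scale (holonomy L a - 1) z.
  rewrite (bD wC (wB + wA)) (bD wB wA) dA dB dC twisted_map_id !subrKA.
  by rewrite twisted_scaleB1 -holg -(twisted_map_deck _ ec) -CE.
apply: zn0; exists (twisted_scale (holonomy L a - 1)^-1 (wC + (wB + wA))).
by rewrite twisted_boundary_scale dw twisted_scaleK.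
Qed.
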